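(* Let $F$ be a field. Let $(X,r)$ be a set-theoretic solution of the quantum Yang-Baxter equation, let $V$ be the $F$-vector space with basis $X$, let $\bar r:V\otimes V\to V\otimes V$ be the linearisation of $r$, and let $X_1,\dots,X_m\subseteq X$ be such that - $X=\bigcup_{i=1}^m X_i$ and $X_i\cap X_j=\emptyset$ for all $i<j\le m$, and - $r(X_i\times X_j)=X_j\times X_i$ for all $i,j\le m$. Let $0\neq\alpha_{i,j}\in F$ for $i,j\le m$, and let $r':V\otimes V\to V\otimes V$ be the linear mapping such that $r'(x\otimes y)=\alpha_{i,j}\,\bar r(x\otimes y)$ for $x\in X_i$ and $y\in X_j$. Then $r'$ satisfies the quantum Yang-Baxter equation.
   Context: A set-theoretic solution of the quantum Yang-Baxter equation is a pair $(X,r)$ with $X$ a non-empty set and $r:X\times X\to X\times X$ a bijection, written $r(x,y)=(\sigma_x(y),\tau_y(x))$, satisfying $r_1r_2r_1=r_2r_1r_2$ on $X^3$, where $r_1=r\times \mathrm{id}_X$, $r_2=\mathrm{id}_X\times r$. (No non-degeneracy is assumed.) The linearisation of $r$ is the linear map with $\bar r(x\otimes y)=\sigma_x(y)\otimes\tau_y(x)$ for $x,y\in X$. A linear map $c:V\otimes V\to V\otimes V$ satisfies the quantum Yang-Baxter equation if $(c\otimes I_V)(I_V\otimes c)(c\otimes I_V)=(I_V\otimes c)(c\otimes I_V)(I_V\otimes c)$. *)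

(* Defs.v *)
From HB Require Import structures.
From mathcomp Require Import all_boot all_algebra.
From mathcomp Require Import boolp classical_sets freeg.

Set Implicit Arguments.
Unset Strict Implicit.
Unset Printing Implicit Defensive.

Import GRing.Theory.
Local Open Scope ring_scope.
Local Open Scope quotient_scope.

(* V \otimes W, in arbitrary dimension: the free F-module on V * W, modulo    *)
(* the submodule generated by the bilinearity relations.                      *)

Section FreeLift.
Context (F : fieldType) (K : choiceType) (U : lmodType F) (f : K -> U).

Lemma freegZU (c k : F) (x : K) : c *: << k *g x >> = << c * k *g x >>.
Proof. by apply/eqP/freeg_eqP=> z; rewrite coeffZ !coeffU mulrA. Qed.

Lemma fgliftD (D1 D2 : {freeg K / F}) :
  fglift f (D1 + D2) = fglift f D1 + fglift f D2.
Proof.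
rewrite -[D1]Freeg_enum -[D2]Freeg_enum -freeg_cat.
by rewrite !fglift_Freeg prelift_cat.
Qed.

Lemma fglift0 : fglift f (0 : {freeg K / F}) = 0.
Proof. by rewrite -freeg_nil fglift_Freeg prelift_nil. Qed.

Lemma fgliftZ c (D : {freeg K / F}) : fglift f (c *: D) = c *: fglift f D.
Proof.
rewrite -[D]freeg_sumE.
elim: (dom D) => [|z s IHs]; first by rewrite big_nil scaler0 fglift0 scaler0.
by rewrite big_cons scalerDr !fgliftD scalerDr IHs freegZU !liftU scalerA.
Qed.

Lemma fglift_linear : linear (fglift f : {freeg K / F} -> U).
Proof. by move=> c D1 D2; rewrite fgliftD fgliftZ. Qed.

End FreeLift.

Section Tensor.
Context (F : fieldType) (V W : lmodType F).

Local Notation pre := {freeg (V * W)%type / F}.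

Inductive bilin_rel : pre -> Prop :=
| BilinL a v v' w :
    bilin_rel (<< (a *: v + v', w) >> - (a *: << (v, w) >> + << (v', w) >>))
| BilinR a v w w' :
    bilin_rel (<< (v, a *: w + w') >> - (a *: << (v, w) >> + << (v, w') >>)).

Definition is_submod (S : pre -> Prop) : Prop :=
  S 0 /\ forall a x y, S x -> S y -> S (a *: x + y).

Definition bilin_span (x : pre) : bool :=
  `[< forall S, is_submod S -> (forall y, bilin_rel y -> S y) -> S x >].

Lemma bilin_span_linear a x y :
  bilin_span x -> bilin_span y -> bilin_span (a *: x + y).
Proof.
move=> /asboolP Sx /asboolP Sy; apply/asboolP => S sS rS.
by apply: sS.2; [apply: Sx | apply: Sy].
Qed.

Lemma bilin_span0 : bilin_span 0.
Proof. by apply/asboolP => S sS _; exact: sS.1. Qed.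

Lemma bilin_spanZ a x : bilin_span x -> bilin_span (a *: x).
Proof.
by move=> sx; rewrite -[_ *: _]addr0 bilin_span_linear ?bilin_span0.
Qed.

Lemma bilin_span_zmod : zmod_closed bilin_span.
Proof.
split=> [|x y sx sy]; first exact: bilin_span0.
by rewrite -scaleN1r addrC; exact: bilin_span_linear.
Qed.

HB.instance Definition _ := GRing.isZmodClosed.Build pre bilin_span
  bilin_span_zmod.

Definition bilin_zmod : zmodClosed pre :=
  GRing.ZmodClosed.clone pre bilin_span _.

Definition tensor_type : Type := Quotient.quot bilin_zmod.

HB.instance Definition _ := GRing.Zmodule.on tensor_type.

Definition tpi (x : pre) : tensor_type := \pi_(Quotient.quot bilin_zmod) x.

Lemma tpi_eq x y : tpi x = tpi y <-> bilin_span (x - y).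
Proof.
rewrite -[bilin_span _]/((x - y) \in bilin_span) Quotient.idealrBE.
by split=> [/eqP|/eqP].
Qed.

Lemma tpiD x y : tpi (x + y) = tpi x + tpi y.
Proof. exact: pi_addr. Qed.

Lemma tpiK (t : tensor_type) : tpi (repr t) = t.
Proof. exact: reprK. Qed.

Definition tscale (a : F) (t : tensor_type) : tensor_type := tpi (a *: repr t).

Lemma tpiZ a x : tpi (a *: x) = tscale a (tpi x).
Proof.
apply/tpi_eq; rewrite -scalerBr; apply: bilin_spanZ.
by apply/tpi_eq; rewrite tpiK.
Qed.

Lemma tscaleA a b t : tscale a (tscale b t) = tscale (a * b) t.
Proof. by rewrite -[t]tpiK -!tpiZ scalerA. Qed.

Lemma tscale1 : left_id 1 tscale.
Proof. by move=> t; rewrite -[t]tpiK -tpiZ scale1r. Qed.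

Lemma tscaleDr : right_distributive tscale +%R.
Proof.
by move=> a t u; rewrite -[t]tpiK -[u]tpiK -tpiD -!tpiZ -tpiD scalerDr.
Qed.

Lemma tscaleDl t : {morph tscale^~ t : a b / a + b}.
Proof. by move=> a b; rewrite -[t]tpiK -!tpiZ -tpiD scalerDl. Qed.

HB.instance Definition _ := GRing.Zmodule_isLmodule.Build F tensor_type
  tscaleA tscale1 tscaleDr tscaleDl.

Definition tensor : lmodType F := GRing.Lmodule.clone F tensor_type _.

Definition tens (v : V) (w : W) : tensor := tpi << (v, w) >>.

Lemma tpi_linear : linear (tpi : pre -> tensor).
Proof. by move=> a x y; rewrite tpiD tpiZ. Qed.

HB.instance Definition _ := GRing.isLinear.Build F pre tensor_type *:%R tpi
  tpi_linear.

Lemma tens_bilinear : bilinear_for *:%R *:%R tens.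
Proof.
split=> [w a v v'|v a w w']; rewrite /tens -tpi_linear; apply/tpi_eq.
  by apply/asboolP => S _; apply; exact: BilinL.
by apply/asboolP => S _; apply; exact: BilinR.
Qed.

HB.instance Definition _ := bilinear_isBilinear.Build F V W tensor *:%R *:%R
  tens tens_bilinear.

Lemma tensor_ind (P : tensor -> Prop) :
    P 0 -> (forall a v w t, P t -> P (a *: tens v w + t)) -> forall t, P t.
Proof.
move=> P0 PD t; rewrite -[t]tpiK -[repr t]freeg_sumE.
elim: (dom _) => [|[v w] s IHs].
  by rewrite big_nil raddf0.
by rewrite big_cons -[coeff _ _]mulr1 -freegZU tpi_linear; exact: PD.
Qed.

Section Lift.
Context (U : lmodType F) (f : {bilinear V -> W -> U}).

Definition tlift (t : tensor) : U := fglift (fun p => f p.1 p.2) (repr t).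

Lemma tlift_pi x : tlift (tpi x) = fglift (fun p => f p.1 p.2) x.
Proof.
set g := fglift _; have g_lin : linear g := @fglift_linear _ _ _ _.
pose gL : {linear pre -> U} := HB.pack g (GRing.isLinear.Build _ _ _ _ g g_lin).
apply/eqP; rewrite -subr_eq0 -[_ - _](raddfB gL); apply/eqP.
have /tpi_eq/asboolP : tpi (repr (tpi x)) = tpi x by exact: tpiK.
move=> /(_ (fun x => gL x = 0)); apply=> [|y].
  by split=> [|a y z y0 z0]; rewrite ?raddf0 // linearP y0 z0 scaler0 addr0.
case=> [a v v' w|a v w w']; rewrite raddfB /= /g;
  rewrite fgliftD fgliftZ !liftU !scale1r.
  by rewrite linearPl subrr.
by rewrite linearPr subrr.
Qed.

Lemma tlift_linear : linear tlift.
Proof.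
move=> a t u; rewrite -[t]tpiK -[u]tpiK -tpi_linear !tlift_pi.
exact: fglift_linear.
Qed.

HB.instance Definition _ := GRing.isLinear.Build F tensor U *:%R tlift
  tlift_linear.

Lemma tliftE v w : tlift (tens v w) = f v w.
Proof. by rewrite tlift_pi liftU scale1r. Qed.

End Lift.

Lemma tensor_ext (U : lmodType F) (f g : {linear tensor -> U}) :
  (forall v w, f (tens v w) = g (tens v w)) -> f =1 g.
Proof.
move=> fg; elim/tensor_ind => [|a v w t IHt]; first by rewrite !raddf0.
by rewrite !linearP fg IHt.
Qed.

End Tensor.

Notation "V \otimes W" := (tensor V W) (at level 40, left associativity).
Notation "v \ot w" := (tens v w) (at level 40, left associativity)
  : ring_scope.

Section TensorMap.
Context (F : fieldType) (V V' W W' : lmodType F).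
Context (f : {linear V -> V'}) (g : {linear W -> W'}).

Definition tmap_bil (v : V) (w : W) : V' \otimes W' := f v \ot g w.

Lemma tmap_bil_bilinear : bilinear_for *:%R *:%R tmap_bil.
Proof.
by split=> [w a v v'|v a w w']; rewrite /tmap_bil linearP ?linearPl ?linearPr.
Qed.

HB.instance Definition _ := bilinear_isBilinear.Build F V W (V' \otimes W')
  *:%R *:%R tmap_bil tmap_bil_bilinear.

Definition tmap : V \otimes W -> V' \otimes W' := tlift tmap_bil.

HB.instance Definition _ := GRing.Linear.on tmap.

Lemma tmapE v w : tmap (v \ot w) = f v \ot g w.
Proof. exact: tliftE. Qed.

End TensorMap.

Section Assoc.
Context (F : fieldType) (V W Z : lmodType F).

Section Left.
Variable z : Z.
Definition tassoc_bil (v : V) (w : W) : V \otimes (W \otimes Z) :=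
  v \ot (w \ot z).
Lemma tassoc_bil_bilinear : bilinear_for *:%R *:%R tassoc_bil.
Proof.
split=> [w a v v'|v a w w']; rewrite /tassoc_bil.
  by rewrite linearPl.
by rewrite linearPl linearPr.
Qed.
HB.instance Definition _ := bilinear_isBilinear.Build F V W
  (V \otimes (W \otimes Z)) *:%R *:%R tassoc_bil tassoc_bil_bilinear.
End Left.

Definition tassoc_bil2 (t : V \otimes W) (z : Z) : V \otimes (W \otimes Z) :=
  tlift (tassoc_bil z) t.

Lemma tassoc_bil2_bilinear : bilinear_for *:%R *:%R tassoc_bil2.
Proof.
have bilr t a z z' :
    tassoc_bil2 t (a *: z + z') = a *: tassoc_bil2 t z + tassoc_bil2 t z'.
  rewrite /tassoc_bil2; elim/tensor_ind: t => [|b v w t IHt].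
    by rewrite !raddf0 addr0.
  have liftE z0 : tlift (tassoc_bil z0) (v \ot w) = v \ot (w \ot z0).
    exact: tliftE.
  rewrite !tlift_linear IHt !liftE !linearPr /=.
  by rewrite !scalerDr !scalerA mulrC addrACA.
by split=> [z a t t'|t a z z']; [exact: linearP | exact: bilr].
Qed.

HB.instance Definition _ := bilinear_isBilinear.Build F (V \otimes W) Z
  (V \otimes (W \otimes Z)) *:%R *:%R tassoc_bil2 tassoc_bil2_bilinear.

Definition tassoc : (V \otimes W) \otimes Z -> V \otimes (W \otimes Z) :=
  tlift tassoc_bil2.

HB.instance Definition _ := GRing.Linear.on tassoc.

Lemma tassocE v w z : tassoc ((v \ot w) \ot z) = v \ot (w \ot z).
Proof. by rewrite /tassoc tliftE; exact: tliftE. Qed.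

Section Right.
Variable v : V.
Definition tassocV_bil (w : W) (z : Z) : (V \otimes W) \otimes Z :=
  (v \ot w) \ot z.
Lemma tassocV_bil_bilinear : bilinear_for *:%R *:%R tassocV_bil.
Proof.
split=> [z a w w'|w a z z']; rewrite /tassocV_bil.
  by rewrite linearPr linearPl.
by rewrite linearPr.
Qed.
HB.instance Definition _ := bilinear_isBilinear.Build F W Z
  ((V \otimes W) \otimes Z) *:%R *:%R tassocV_bil tassocV_bil_bilinear.
End Right.

Definition tassocV_bil2 (v : V) (t : W \otimes Z) : (V \otimes W) \otimes Z :=
  tlift (tassocV_bil v) t.

Lemma tassocV_bil2_bilinear : bilinear_for *:%R *:%R tassocV_bil2.
Proof.
have bill t a v v' :
    tassocV_bil2 (a *: v + v') t = a *: tassocV_bil2 v t + tassocV_bil2 v' t.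
  rewrite /tassocV_bil2; elim/tensor_ind: t => [|b w z t IHt].
    by rewrite !raddf0 addr0.
  have liftE v0 : tlift (tassocV_bil v0) (w \ot z) = (v0 \ot w) \ot z.
    exact: tliftE.
  rewrite !tlift_linear IHt !liftE !linearPl /=.
  by rewrite !scalerDr !scalerA mulrC addrACA.
by split=> [t a v v'|v a t t']; [exact: bill | exact: linearP].
Qed.

HB.instance Definition _ := bilinear_isBilinear.Build F V (W \otimes Z)
  ((V \otimes W) \otimes Z) *:%R *:%R tassocV_bil2 tassocV_bil2_bilinear.

Definition tassocV : V \otimes (W \otimes Z) -> (V \otimes W) \otimes Z :=
  tlift tassocV_bil2.

HB.instance Definition _ := GRing.Linear.on tassocV.

Lemma tassocVE v w z : tassocV (v \ot (w \ot z)) = (v \ot w) \ot z.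
Proof. by rewrite /tassocV tliftE; exact: tliftE. Qed.

Lemma tassocVK : cancel tassocV tassoc.
Proof.
elim/tensor_ind=> [|a v t u IHu]; first by rewrite !raddf0.
rewrite !linearP /= IHu; congr (_ *: _ + _).
elim/tensor_ind: t {u IHu} => [|b w z t IHt]; first by rewrite linear0r !raddf0.
by rewrite linearPr !linearP /= IHt tassocVE tassocE.
Qed.

Lemma tassocK : cancel tassoc tassocV.
Proof.
elim/tensor_ind=> [|a t z u IHu]; first by rewrite !raddf0.
rewrite !linearP /= IHu; congr (_ *: _ + _).
elim/tensor_ind: t {u IHu} => [|b v w t IHt]; first by rewrite linear0l !raddf0.
by rewrite linearPl !linearP /= IHt tassocE tassocVE.
Qed.

End Assoc.

Arguments tassoc {F V W Z}.
Arguments tassocV {F V W Z}.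

Section YangBaxter.
Context (F : fieldType) (V : lmodType F).
Context (c : {linear V \otimes V -> V \otimes V}).

(* Both act on (V \otimes V) \otimes V; I \otimes c is transported there      *)
(* along the associativity isomorphism.                                       *)
Definition ybe12 : V \otimes V \otimes V -> V \otimes V \otimes V :=
  tmap c idfun.
Definition ybe23 : V \otimes V \otimes V -> V \otimes V \otimes V :=
  tassocV \o tmap idfun c \o tassoc.

HB.instance Definition _ := GRing.Linear.on ybe12.
HB.instance Definition _ := GRing.Linear.on ybe23.

Lemma ybe12E u v w : ybe12 ((u \ot v) \ot w) = c (u \ot v) \ot w.
Proof. exact: tmapE. Qed.

Lemma ybe23E u v w : ybe23 ((u \ot v) \ot w) = tassocV (u \ot c (v \ot w)).
Proof. by rewrite /ybe23 /= tassocE tmapE. Qed.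

Definition yang_baxter : Prop :=
  ybe12 \o ybe23 \o ybe12 =1 ybe23 \o ybe12 \o ybe23.

End YangBaxter.

Section SetTheoretic.
Context (X : Type) (r : X * X -> X * X).

Definition sigma (x y : X) : X := (r (x, y)).1.
Definition tau (y x : X) : X := (r (x, y)).2.

Definition braid1 (p : X * X * X) : X * X * X := (r p.1, p.2).
Definition braid2 (p : X * X * X) : X * X * X :=
  let q := r (p.1.2, p.2) in (p.1.1, q.1, q.2).

Definition set_solution : Prop :=
  [/\ inhabited X, bijective r &
      braid1 \o braid2 \o braid1 =1 braid2 \o braid1 \o braid2].

End SetTheoretic.

Definition is_basis (F : fieldType) (X : Type) (V : lmodType F) (b : X -> V) :=
  (forall n (x : 'I_n -> X) (a : 'I_n -> F), injective x ->
     \sum_i a i *: b (x i) = 0 -> forall i, a i = 0) /\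
  (forall v, exists n (x : 'I_n -> X) (a : 'I_n -> F),
     v = \sum_i a i *: b (x i)).

Definition is_linearisation (F : fieldType) (X : Type) (r : X * X -> X * X)
    (V : lmodType F) (b : X -> V)
    (rbar : {linear V \otimes V -> V \otimes V}) : Prop :=
  forall x y, rbar (b x \ot b y) = b (sigma r x y) \ot b (tau r y x).

(* Main.v *)
From HB Require Import structures.
Require Import Defs.
From mathcomp Require Import all_boot all_algebra.
From mathcomp Require Import boolp classical_sets.

(** By linearity it is enough to compare both sides of the equation on the
vectors [b x \ot b y \ot b z] ([tensor3_basis_ext]).  There each factor acts as
the corresponding set-theoretic braid, up to a scalar ([ybe12_basis],
[ybe23_basis]).  Let x, y, z lie in the blocks i, j, k.  Since r exchanges the
blocks of its two arguments, the blocks evolve as three crossing strands: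
  (i, j, k) -> (j, i, k) -> (j, k, i) -> (k, j, i)  on the left-hand side, and
  (i, j, k) -> (i, k, j) -> (k, i, j) -> (k, j, i)  on the right-hand side.
Each pair of strands crosses exactly once on either side, in the same order of
its two labels, so both sides pick up the same scalar
[alpha i j * alpha i k * alpha j k], and what remains is the set-theoretic
braid relation for r. *)

Set Implicit Arguments.
Unset Strict Implicit.

Import GRing.Theory.
Local Open Scope ring_scope.
Local Open Scope classical_set_scope.

Lemma linear_span_ext (F : fieldType) (X : Type) (V U : lmodType F)
    (b : X -> V) (b_basis : is_basis b) (f g : {linear V -> U}) :
  (forall x, f (b x) = g (b x)) -> f =1 g.
Proof.
move=> fg v; have [n [x [a ->]]] := b_basis.2 v.
by rewrite !linear_sum; apply: eq_bigr => i _; rewrite !linearZ /= fg.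
Qed.

Section TripleTensor.
Context (F : fieldType) (X : Type) (V : lmodType F) (b : X -> V).

Definition tens3 (p : X * X * X) : V \otimes V \otimes V :=
  (b p.1.1 \ot b p.1.2) \ot b p.2.

(** Freezing two of the three arguments of [u \ot v \ot w] leaves a linear map,
so each argument in turn can be reduced to basis vectors. *)
Lemma tensor3_basis_ext (b_basis : is_basis b) (U : lmodType F)
    (f g : {linear V \otimes V \otimes V -> U}) :
  (forall p, f (tens3 p) = g (tens3 p)) -> f =1 g.
Proof.
move=> fg.
pose fix1 (h : {linear V \otimes V \otimes V -> U}) v w u := h (u \ot v \ot w).
pose fix2 (h : {linear V \otimes V \otimes V -> U}) u w v := h (u \ot v \ot w).
pose fix3 (h : {linear V \otimes V \otimes V -> U}) u v w := h (u \ot v \ot w).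
have lin1 h v w : linear (fix1 h v w).
  by move=> a u u'; rewrite /fix1 linearPl linearPl linearP.
have lin2 h u w : linear (fix2 h u w).
  by move=> a v v'; rewrite /fix2 linearPr linearPl linearP.
have lin3 h u v : linear (fix3 h u v).
  by move=> a w w'; rewrite /fix3 linearPr linearP.
pose L1 h v w : {linear V -> U} :=
  HB.pack (fix1 h v w) (GRing.isLinear.Build _ _ _ _ _ (lin1 h v w)).
pose L2 h u w : {linear V -> U} :=
  HB.pack (fix2 h u w) (GRing.isLinear.Build _ _ _ _ _ (lin2 h u w)).
pose L3 h u v : {linear V -> U} :=
  HB.pack (fix3 h u v) (GRing.isLinear.Build _ _ _ _ _ (lin3 h u v)).
apply: tensor_ext => t w; elim/tensor_ind: t => [|a u v t IHt].
  by rewrite linear0l !raddf0.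
rewrite linearPl !linearP IHt; congr (_ *: _ + _).
refine (linear_span_ext b_basis (f := L1 f v w) (g := L1 g v w) _ u) => x.
refine (linear_span_ext b_basis
  (f := L2 f (b x) w) (g := L2 g (b x) w) _ v) => y.
refine (linear_span_ext b_basis
  (f := L3 f (b x) (b y)) (g := L3 g (b x) (b y)) _ w) => z.
exact: (fg (x, y, z)).
Qed.

Context (r : X * X -> X * X) (c : {linear V \otimes V -> V \otimes V}).

Lemma ybe12_basis (a : F) (p : X * X * X) :
    c (b p.1.1 \ot b p.1.2) =
      a *: (b (sigma r p.1.1 p.1.2) \ot b (tau r p.1.2 p.1.1)) ->
  ybe12 c (tens3 p) = a *: tens3 (braid1 r p).
Proof.
case: p => [[x y] z] /= cxy.
by rewrite /tens3 ybe12E cxy linearZl_LR.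
Qed.

Lemma ybe23_basis (a : F) (p : X * X * X) :
    c (b p.1.2 \ot b p.2) =
      a *: (b (sigma r p.1.2 p.2) \ot b (tau r p.2 p.1.2)) ->
  ybe23 c (tens3 p) = a *: tens3 (braid2 r p).
Proof.
case: p => [[x y] z] /= cyz.
by rewrite /tens3 ybe23E cyz linearZr_LR linearZ /= tassocVE.
Qed.

End TripleTensor.

Section Blocks.
Context (F : fieldType) (X : Type) (r : X * X -> X * X).
Context (V : lmodType F) (b : X -> V) (I : Type) (Xs : I -> set X).
Context (Xs_r : forall i j, r @` (Xs i `*` Xs j) = Xs j `*` Xs i).
Context (alpha : I -> I -> F) (c : {linear V \otimes V -> V \otimes V}).
Context (cE : forall i j x y, Xs i x -> Xs j y ->
  c (b x \ot b y) = alpha i j *: (b (sigma r x y) \ot b (tau r y x))).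

Definition in_blocks (i j k : I) (p : X * X * X) : Prop :=
  [/\ Xs i p.1.1, Xs j p.1.2 & Xs k p.2].

Lemma sol_blocks i j x y : Xs i x -> Xs j y ->
  Xs j (sigma r x y) /\ Xs i (tau r y x).
Proof.
move=> Xx Xy; suff: (Xs j `*` Xs i) (r (x, y)) by [].
by rewrite -Xs_r; exists (x, y).
Qed.

Lemma braid1_blocks i j k p :
  in_blocks i j k p -> in_blocks j i k (braid1 r p).
Proof.
case: p => [[x y] z] [Xx Xy Xz].
by have [Xs1 Xt1] := sol_blocks Xx Xy.
Qed.

Lemma braid2_blocks i j k p :
  in_blocks i j k p -> in_blocks i k j (braid2 r p).
Proof.
case: p => [[x y] z] [Xx Xy Xz].
by have [Xs1 Xt1] := sol_blocks Xy Xz.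
Qed.

Lemma ybe12_blocks i j k p : in_blocks i j k p ->
  ybe12 c (tens3 b p) = alpha i j *: tens3 b (braid1 r p).
Proof. by case=> Xx Xy _; apply: ybe12_basis; exact: cE. Qed.

Lemma ybe23_blocks i j k p : in_blocks i j k p ->
  ybe23 c (tens3 b p) = alpha j k *: tens3 b (braid2 r p).
Proof. by case=> _ Xy Xz; apply: ybe23_basis; exact: cE. Qed.

(** The scalar is collected in the order (i, j), (i, k), (j, k); the other side
of the equation meets the same crossings in the reverse order. *)
Lemma ybe_lhs_blocks i j k p : in_blocks i j k p ->
  (ybe12 c \o ybe23 c \o ybe12 c) (tens3 b p) =
    (alpha i j * alpha i k * alpha j k) *:
      tens3 b ((braid1 r \o braid2 r \o braid1 r) p).
Proof.
move=> p0; have p1 := braid1_blocks p0.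
have p2 := braid2_blocks p1.
rewrite /= (ybe12_blocks p0) linearZ /= (ybe23_blocks p1).
by rewrite !linearZ /= (ybe12_blocks p2) !scalerA.
Qed.

Lemma ybe_rhs_blocks i j k p : in_blocks i j k p ->
  (ybe23 c \o ybe12 c \o ybe23 c) (tens3 b p) =
    (alpha i j * alpha i k * alpha j k) *:
      tens3 b ((braid2 r \o braid1 r \o braid2 r) p).
Proof.
move=> p0; have p1 := braid2_blocks p0.
have p2 := braid1_blocks p1.
rewrite /= (ybe23_blocks p0) linearZ /= (ybe12_blocks p1).
rewrite !linearZ /= (ybe23_blocks p2) !scalerA.
by rewrite mulrC mulrA mulrAC.
Qed.

End Blocks.

Unset Implicit Arguments.
Set Strict Implicit.

Theorem proposition19 (F : fieldType)
    (X : Type) (r : X * X -> X * X) (r_sol : set_solution r)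
    (V : lmodType F) (b : X -> V) (b_basis : is_basis b)
    (rbar : {linear V \otimes V -> V \otimes V})
    (rbar_lin : is_linearisation r b rbar)
    (m : nat) (Xs : 'I_m -> set X)
    (Xs_cover : [set: X] = \bigcup_(i in [set: 'I_m]) Xs i)
    (Xs_disjoint : forall i j : 'I_m, (i < j)%N -> Xs i `&` Xs j = set0)
    (Xs_r : forall i j : 'I_m, r @` (Xs i `*` Xs j) = Xs j `*` Xs i)
    (alpha : 'I_m -> 'I_m -> F) (alpha_neq0 : forall i j, alpha i j != 0)
    (r' : {linear V \otimes V -> V \otimes V})
    (r'_def : forall (i j : 'I_m) (x y : X), Xs i x -> Xs j y ->
       r' (b x \ot b y) = alpha i j *: rbar (b x \ot b y)) :
  yang_baxter r'.
Proof.
have r'E i j x y : Xs i x -> Xs j y ->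
    r' (b x \ot b y) = alpha i j *: (b (sigma r x y) \ot b (tau r y x)).
  by move=> Xx Xy; rewrite (r'_def i j) // rbar_lin.
have block x : exists i, Xs i x.
  have : [set: X] x by [].
  by rewrite Xs_cover => -[i _ Xx]; exists i.
have [_ _ braid] := r_sol.
apply: (tensor3_basis_ext b_basis) => p.
have [i Xi] := block p.1.1; have [j Xj] := block p.1.2.
have [k Xk] := block p.2.
have ijk : in_blocks Xs i j k p by [].
have lhs := ybe_lhs_blocks Xs_r r'E ijk.
have rhs := ybe_rhs_blocks Xs_r r'E ijk.
by rewrite [LHS]lhs [RHS]rhs braid.
Qed.
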